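(* Let $1\le p<\infty$, let $\vec\mu=(\mu_0,\dots,\mu_m)$ be a standard vector of measures, and let $\|\cdot\|_{p,\vec\mu}$ be the associated Sobolev $p$-norm. Let $n$ be a nonnegative integer and let $P_n$ be a monic polynomial of degree $n$ such that for every polynomial $q$ of degree at most $n-1$ $$\langle P_n,q\rangle_{p,\vec\mu}:=\sum_{k=0}^{m}\int_{\Delta_k} q^{(k)}(x)\,\operatorname{sgn}\!\left(P_n^{(k)}(x)\right)\left|P_n^{(k)}(x)\right|^{p-1}\,d\mu_k(x)=0 .$$ Then $P_n$ is a minimal polynomial of degree $n$ with respect to $\|\cdot\|_{p,\vec\mu}$, i.e. $\|P_n\|_{p,\vec\mu}\le\|Q\|_{p,\vec\mu}$ for every monic polynomial $Q$ of degree $n$.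
   Context: Let $\mathbb{P}$ denote the space of all polynomials. A vector of measures $\vec\mu=(\mu_0,\dots,\mu_m)$, $m\ge 0$ an integer, consists of finite positive Borel measures $\mu_k$ with $\operatorname{supp}\mu_k\subset\mathbb{R}$ and $\mathbb{P}\subset L^1(\mu_k)$. It is called standard if $\operatorname{supp}\mu_0$ has infinitely many points. $\Delta_k$ is the convex hull of $\operatorname{supp}\mu_k$ (the smallest interval containing it). The Sobolev $p$-norm on $\mathbb{P}$ is $$\|f\|_{p,\vec\mu}=\left(\sum_{k=0}^m\int_{\Delta_k}|f^{(k)}|^p\,d\mu_k\right)^{1/p}.$$ Here $\operatorname{sgn}(y)=y/|y|$ if $y\ne0$ and $\operatorname{sgn}(0)=0$; for $p=1$ the product $\operatorname{sgn}(y)|y|^{p-1}$ means $\operatorname{sgn}(y)$. For $n=0$ the only polynomial of degree at most $-1$ is $0$. *)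

(* Defs.v *)
From HB Require Import structures.
From mathcomp Require Import all_boot all_order all_algebra.
From mathcomp Require Import all_classical all_reals all_analysis.
Import Order.TTheory GRing.Theory Num.Theory.
Import numFieldNormedType.Exports.
Set Implicit Arguments.
Unset Strict Implicit.
Unset Printing Implicit Defensive.
Local Open Scope classical_set_scope.
Local Open Scope ring_scope.

(* [measurableTypeR R] is R with its Borel sigma-algebra, so this is the type
   of finite positive Borel measures on R. *)
Notation borel_measure R := {finite_measure set (measurableTypeR R) -> \bar R}.

(* The topological support: the points all of whose open neighborhoods have
   positive measure. *)
Definition supp {R : realType} (mu : borel_measure R) : set R :=
  [set x | forall U : set R, open U -> U x -> (0 < mu U)%E].

(* Empty when [supp mu] is empty, i.e. for the zero measure. *)
Definition supp_hull {R : realType} (mu : borel_measure R) : set R :=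
  smallest (@is_interval R) (supp mu).

Definition vector_of_measures {R : realType} {m : nat}
    (mu : 'I_m.+1 -> borel_measure R) : Prop :=
  forall (k : 'I_m.+1) (q : {poly R}),
    (mu k).-integrable setT (fun x => (q.[x])%:E).

Definition standard {R : realType} {m : nat}
    (mu : 'I_m.+1 -> borel_measure R) : Prop :=
  vector_of_measures mu /\ infinite_set (supp (mu ord0)).

(* Extended-real valued, so that no convention for divergent integrals is
   involved; for a vector of measures in the above sense it is always finite,
   and so is [sobolev_pairing] below. *)
Definition sobolev_norm {R : realType} {m : nat}
    (mu : 'I_m.+1 -> borel_measure R) (p : R) (f : {poly R}) : \bar R :=
  ((\sum_(k < m.+1)
     \int[mu k]_(x in supp_hull (mu k)) (`| f^`(k).[x] | `^ p)%:E) `^ p^-1)%E.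

(* For p = 1 the factor [|y| `^ 0] is 1, also at y = 0, so that the integrand
   is then q^`(k) times the sign of P^`(k), as it should be. *)
Definition sobolev_pairing {R : realType} {m : nat}
    (mu : 'I_m.+1 -> borel_measure R) (p : R) (P q : {poly R}) : \bar R :=
  (\sum_(k < m.+1)
     \int[mu k]_(x in supp_hull (mu k))
       (q^`(k).[x] * (Num.sg P^`(k).[x] * `| P^`(k).[x] | `^ (p - 1)))%:E)%E.

(* [size f = deg f + 1] for nonzero f. *)
Definition monic_of_degree {R : realType} (n : nat) (f : {poly R}) : Prop :=
  f \is monic /\ size f = n.+1.

Definition minimal_polynomial {R : realType} {m : nat}
    (mu : 'I_m.+1 -> borel_measure R) (p : R) (n : nat) (f : {poly R}) : Prop :=
  monic_of_degree n f /\
  forall Q : {poly R}, monic_of_degree n Q ->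
    (sobolev_norm mu p f <= sobolev_norm mu p Q)%E.

(* Main.v *)
(* Convexity of [t |-> |t|^p] gives, pointwise,
   |Q^(k)|^p >= |P^(k)|^p + p (Q - P)^(k) sgn(P^(k)) |P^(k)|^(p-1).
   Integrating over the hull of the support of the k-th measure and summing
   over k, the linear term becomes the pairing of P with p (Q - P). That
   polynomial has degree at most n - 1 because P and Q are both monic of
   degree n, so its pairing with P vanishes. *)
Require Import Defs.
From HB Require Import structures.
From mathcomp Require Import all_boot all_order all_algebra.
From mathcomp Require Import all_classical all_reals all_analysis.
From mathcomp Require Import measurable_realfun ring lra.
Import Order.TTheory GRing.Theory Num.Theory.
Import numFieldNormedType.Exports.
Local Open Scope classical_set_scope.
Local Open Scope ring_scope.

(** No derivative is taken: as sgn(a) b <= |b|, it suffices that p |b| |a|^(p-1) <= |b|^p + (p-1)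
    |a|^p, which is Young's inequality for |b| and |a|^(p-1) with exponents p and p/(p-1). *)
Lemma powR_tangent_le (R : realType) (p a b : R) : 1 <= p ->
  `|a| `^ p + p * (b - a) * (Num.sg a * `|a| `^ (p - 1)) <= `|b| `^ p.
Proof.
move=> p1; have p0 : 0 < p by lra.
have sab : Num.sg a * b <= `|b|.
  rewrite (le_trans (ler_norm _))// normrM normr_sg.
  by case: (a != 0); rewrite ?mul1r// mul0r.
have aE : `|a| * `|a| `^ (p - 1) = `|a| `^ p by rewrite mulr_powRB1.
have -> : `|a| `^ p + p * (b - a) * (Num.sg a * `|a| `^ (p - 1)) =
    p * (Num.sg a * b) * `|a| `^ (p - 1) - (p - 1) * `|a| `^ p.
  by rewrite -aE normrEsg; ring.
have tangent : p * (`|b| * `|a| `^ (p - 1)) <=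
    `|b| `^ p + (p - 1) * `|a| `^ p.
  (* For p = 1 the conjugate exponent is infinite, so this case is separate: |a|^0 = 1, also at a =
     0, and both sides equal |b|. *)
  have [->|pn1] := eqVneq p 1.
    by rewrite subrr powRr0 powRr1//; lra.
  have pm1 : 0 < p - 1 by rewrite subr_gt0 lt_def pn1.
  have q0 : 0 < p / (p - 1) by rewrite divr_gt0.
  have pq : p^-1 + (p / (p - 1))^-1 = 1 by field; lra.
  have := conjugate_powR (normr_ge0 b) (powR_ge0 `|a| (p - 1)) p0 q0 pq.
  have -> : (`|a| `^ (p - 1)) `^ (p / (p - 1)) = `|a| `^ p.
    by rewrite -powRrM; congr (_ `^ _); field; lra.
  rewrite -(ler_pM2l p0) => /le_trans; apply.
  by rewrite le_eqVlt; apply/orP; left; apply/eqP; field; lra.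
have : p * (Num.sg a * b) * `|a| `^ (p - 1) <= p * (`|b| * `|a| `^ (p - 1)).
  by rewrite -mulrA ler_wpM2l ?(ltW p0)// ler_wpM2r ?powR_ge0.
lra.
Qed.

(** Supplies a polynomial majorant for real powers. The exponent exceeds s and is even, which
    removes the absolute value; the summand 1 covers |y| <= 1. *)
Lemma powR_le_1D_expr (R : realType) (s y : R) : 0 <= s ->
  `|y| `^ s <= 1 + y ^+ (Num.truncn s).+1.*2.
Proof.
move=> s0; set N := (Num.truncn s).+1.
have sN : s <= N.*2%:R.
  by rewrite (le_trans (ltW (truncnS_gt s)))// ler_nat -addnn leq_addr.
have yE : y ^+ N.*2 = `|y| ^+ N.*2 by rewrite -mul2n !exprM real_normK ?num_real.
have [y1|/ltW y1] := leP `|y| 1.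
  have := ge0_ler_powR s0 (normr_ge0 y) ler01 y1.
  by rewrite powR1 => /le_trans; apply; rewrite lerDl yE exprn_ge0.
by rewrite yE (le_trans (ler_powR y1 sN))// powR_mulrn// lerDr.
Qed.

Lemma measurable_sgr (R : realType) :
  measurable_fun [set: R] (fun x : R => Num.sg x).
Proof.
apply: nondecreasing_measurable => // x y xy.
by move: xy; case: (sgrP x) => ?; case: (sgrP y) => ? ?; lra.
Qed.

(** An intersection of intervals is an interval, hence Borel. *)
Lemma measurable_supp_hull (R : realType) (mu : borel_measure R) :
  measurable (supp_hull mu).
Proof.
apply: is_interval_measurable => x y hx hy z xyz A [Aitv subA].
have inA z0 (hz0 : supp_hull mu z0) : A z0 := hz0 A (conj Aitv subA).
exact: Aitv (inA x hx) (inA y hy) _ xyz.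
Qed.

Section PolynomialIntegrability.
Variables (R : realType) (mu : borel_measure R) (D : set R).
Hypothesis mD : measurable D.
Hypothesis mu_poly : forall q : {poly R},
  mu.-integrable [set: R] (fun x => (q.[x])%:E).

Lemma integrable_poly_bound (f : R -> R) (q : {poly R}) :
  measurable_fun [set: R] f -> (forall x, `|f x| <= `|q.[x]|) ->
  mu.-integrable D (EFin \o f).
Proof.
move=> mf fq; apply: (@integrableS _ _ _ _ setT) => //.
apply: le_integrable (mu_poly q) => //; first exact/measurable_EFinP.
by move=> x _; rewrite /= lee_fin.
Qed.

Lemma measurable_norm_powR_poly (f : {poly R}) (s : R) :
  measurable_fun [set: R] (fun x => `|f.[x]| `^ s).
Proof.
apply: (measurableT_comp (measurable_powR s)).
by apply: measurableT_comp => //; exact: measurable_poly.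
Qed.

Lemma integrable_poly_powR (f : {poly R}) (s : R) : 0 <= s ->
  mu.-integrable D (fun x => (`|f.[x]| `^ s)%:E).
Proof.
move=> s0.
apply: (@integrable_poly_bound _ (1 + f ^+ (Num.truncn s).+1.*2)).
  exact: measurable_norm_powR_poly.
move=> x; rewrite hornerD hornerC horner_exp (ger0_norm (powR_ge0 _ _)).
by apply: le_trans (ler_norm _); exact: powR_le_1D_expr.
Qed.

Lemma integrable_poly_sgr_powR (f g : {poly R}) (s : R) : 0 <= s ->
  mu.-integrable D
    (fun x => (g.[x] * (Num.sg f.[x] * `|f.[x]| `^ s))%:E).
Proof.
move=> s0.
(* The sign has absolute value at most 1, so g times the majorant of |f|^s dominates. *)
apply: (@integrable_poly_bound _ (g * (1 + f ^+ (Num.truncn s).+1.*2))).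
  apply: measurable_funM; first exact: measurable_poly.
  apply: measurable_funM; last exact: measurable_norm_powR_poly.
  by apply: (measurableT_comp (@measurable_sgr R)); exact: measurable_poly.
move=> x; rewrite hornerM hornerD hornerC horner_exp !normrM ler_wpM2l//.
rewrite normr_sg (ger0_norm (powR_ge0 _ _)).
apply: le_trans (ler_norm _); apply: (@le_trans _ _ (`|f.[x]| `^ s)).
  by rewrite ler_piMl ?powR_ge0//; case: (_ != _).
exact: powR_le_1D_expr.
Qed.

End PolynomialIntegrability.

(** The coefficients of degree n are both 1 and cancel. For n = 0 the bound forces Q - P = 0. *)
Lemma size_monicB_leq (R : realType) (n : nat) (P Q : {poly R}) :
  monic_of_degree n P -> monic_of_degree n Q -> (size (Q - P)%R <= n)%N.
Proof.
move=> [/monicP P1 sP] [/monicP Q1 sQ]; apply/leq_sizeP => j.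
rewrite leq_eqVlt coefB => /predU1P[<-|nj].
  by move: P1 Q1; rewrite !lead_coefE sP sQ /= => -> ->; rewrite subrr.
by rewrite !nth_default ?subrr ?sP ?sQ.
Qed.

(** The factor p of the tangent inequality sits inside the test polynomial, which spares a proof
    that the pairing is homogeneous. *)
Lemma le_sobolev_norm (R : realType) (m : nat) (mu : 'I_m.+1 -> borel_measure R)
    (p : R) (P Q : {poly R}) : 1 <= p -> vector_of_measures mu ->
  sobolev_pairing mu p P (p *: (Q - P)) = 0%E ->
  (sobolev_norm mu p P <= sobolev_norm mu p Q)%E.
Proof.
move=> p1 mu_poly pair0; have p0 : 0 <= p by lra.
have sum_ge0 f : (0 <= \sum_(k < m.+1)
    \int[mu k]_(x in supp_hull (mu k)) (`|f^`(k).[x]| `^ p)%:E)%E.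
  by apply: sume_ge0 => k _; apply: integral_ge0 => x _; rewrite lee_fin powR_ge0.
(* The root of order p is monotone on [0, +oo], so the sums under it are compared. *)
apply: gt0_ler_poweR; rewrite ?invr_ge0 ?in_itv/= ?sum_ge0 ?leey//.
(* Adding the vanishing pairing on the left reduces the claim to one inequality of integrals for
   each k. *)
rewrite -[leLHS]adde0 -[X in (_ + X)%E]pair0 -big_split /=; apply: lee_sum => k _.
have mD := @measurable_supp_hull _ (mu k).
have iP f := @integrable_poly_powR _ _ _ mD (mu_poly k) f _ p0.
have pm1 : 0 <= p - 1 by lra.
have iPQ := @integrable_poly_sgr_powR _ _ _ mD (mu_poly k) P^`(k)
  (p *: (Q - P))^`(k) _ pm1.
rewrite -integralD//; apply: le_integral => //.
  exact: integrableD.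
(* By linearity of the k-th derivative this is the tangent inequality at a = P^(k)(x), b =
   Q^(k)(x). *)
move=> x _; rewrite -EFinD lee_fin derivnZ derivnB hornerZ hornerD hornerN.
exact: powR_tangent_le.
Qed.

Theorem theorem2p1 (R : realType) (p : R) (m : nat)
    (mu : 'I_m.+1 -> borel_measure R) (n : nat) (P : {poly R})
    (hp : 1 <= p)
    (hmu : standard mu)
    (hP : monic_of_degree n P)
    (horth : forall q : {poly R}, (size q <= n)%N ->
       sobolev_pairing mu p P q = 0%E) :
  minimal_polynomial mu p n P.
Proof.
split=> // Q hQ; apply: le_sobolev_norm => //; first exact: hmu.1.
by apply: horth; rewrite (leq_trans (size_scale_leq _ _))// size_monicB_leq.
Qed.
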